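(* Suppose that $B$ is a closed selfadjoint subalgebra of an operator algebra $A$, and that $P:A\to B$ is an idempotent Jordan homomorphism and $B$-bimodule map. Then $P$ is a homomorphism.
   Context: An operator algebra is a norm-closed subalgebra $A$, containing the identity, of a unital $C^*$-algebra $C$; ''selfadjoint'' refers to the involution of $C$, so $B$ is a $C^*$-algebra. A Jordan homomorphism is a linear map $P$ with $P(a^2)=P(a)^2$ for all $a$. Idempotent means $P\circ P=P$. A $B$-bimodule map satisfies $P(b_1ab_2)=b_1P(a)b_2$ for $a\in A$, $b_1,b_2\in B$. *)

(* Defs.v *)
From HB Require Import structures.
From mathcomp Require Import all_boot all_order all_algebra.
From mathcomp Require Import all_classical all_reals all_analysis.
From mathcomp Require Import complex.

Set Implicit Arguments.
Unset Strict Implicit.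
Unset Printing Implicit Defensive.

Import Order.TTheory GRing.Theory Num.Theory.
Import numFieldNormedType.Exports.

Local Open Scope classical_set_scope.
Local Open Scope ring_scope.

(* Unital complex C*-algebras. HB rejects the join of GRing.Algebra with
   CompleteNormedModule (Num.NumDomain already joins their ancestors), so the
   ring operations are fields of the mixin, and the algType structure built from
   them is then declared on every C*-algebra; cstar_mul x y and cstar_one are
   convertible to x * y and 1. The instances add no additive or scalar structure,
   hence the non_forgetful_inheritance attribute is harmless.
   As for every normed module of the library, the norm is valued in the
   nonnegative reals of the scalar field R[i]; as for every algType, 1 != 0
   (equivalently, `|1| = 1). *)
HB.mixin Record CompleteNormedModule_isCStarAlgebra (R : realType) V
    & CompleteNormedModule R[i] V := {
  cstar_one : V;
  cstar_mul : V -> V -> V;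
  cstar_mulA : associative cstar_mul;
  cstar_mul1l : left_id cstar_one cstar_mul;
  cstar_mul1r : right_id cstar_one cstar_mul;
  cstar_mulDl : left_distributive cstar_mul +%R;
  cstar_mulDr : right_distributive cstar_mul +%R;
  cstar_oner_neq0 : cstar_one != 0;
  cstar_scaleAl : forall (k : R[i]) (x y : V),
    k *: cstar_mul x y = cstar_mul (k *: x) y;
  cstar_scaleAr : forall (k : R[i]) (x y : V),
    k *: cstar_mul x y = cstar_mul x (k *: y);
  cstar_normM_le : forall x y : V, `|cstar_mul x y| <= `|x| * `|y|;
  star : V -> V;
  starK : involutive star;
  starD : {morph star : x y / x + y};
  starZ : forall (k : R[i]) (x : V), star (k *: x) = Num.conj k *: star x;
  starM : forall x y : V, star (cstar_mul x y) = cstar_mul (star y) (star x);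
  cstar_identity : forall x : V, `|cstar_mul (star x) x| = `|x| ^+ 2
}.

#[short(type="cstarAlgType")]
HB.structure Definition CStarAlgebra (R : realType) :=
  {V of CompleteNormedModule R[i] V
   & CompleteNormedModule_isCStarAlgebra R V}.

#[non_forgetful_inheritance]
HB.instance Definition _ (R : realType) (V : cstarAlgType R) :=
  GRing.Zmodule_isNzRing.Build (CStarAlgebra.sort V)
    cstar_mulA cstar_mul1l cstar_mul1r cstar_mulDl cstar_mulDr cstar_oner_neq0.

#[non_forgetful_inheritance]
HB.instance Definition _ (R : realType) (V : cstarAlgType R) :=
  GRing.Lmodule_isLalgebra.Build R[i] (CStarAlgebra.sort V) cstar_scaleAl.

#[non_forgetful_inheritance]
HB.instance Definition _ (R : realType) (V : cstarAlgType R) :=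
  GRing.Lalgebra_isAlgebra.Build R[i] (CStarAlgebra.sort V) cstar_scaleAr.

Section OperatorAlgebras.
Variables (R : realType) (C : cstarAlgType R).
Implicit Types (A B : set C) (P : C -> C).

(* subalg_closed includes 1 \in A. *)
Definition operator_algebra A := GRing.subalg_closed (mem A) /\ closed A.

(* No unit is required in B. *)
Definition closed_selfadjoint_subalgebra B A :=
  [/\ B `<=` A, GRing.submod_closed (mem B), GRing.mulr_2closed (mem B),
      {homo star : b / b \in B} & closed B].

(* Maps defined on A are represented by functions on C, all of whose
   properties are required on A only. *)
Definition linear_on A P :=
  forall k : R[i], {in A &, forall x y, P (k *: x + y) = k *: P x + P y}.

Definition idempotent_on A P := {in A, forall a, P (P a) = P a}.

Definition jordan_homomorphism_on A P :=
  linear_on A P /\ {in A, forall a, P (a ^+ 2) = P a ^+ 2}.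

Definition homomorphism_on A P :=
  linear_on A P /\ {in A &, {morph P : x y / x * y}}.

Definition bimodule_map_on A B P :=
  forall a b1 b2, a \in A -> b1 \in B -> b2 \in B ->
    P (b1 * a * b2) = b1 * P a * b2.

End OperatorAlgebras.

(* Main.v *)
(** Write [A = P(A) + K] with [K = ker P], a [B]-bimodule. It suffices to show
    [K K] in [K]. For [x, y] in [K] put [b = P (x y)], so that [P (y x) = - b].
    The Jordan triple [x y x] lies in [K], hence so does the Jordan product of
    [x y x] and [y], that is [(x y)^2 + (y x)^2]; its image is [2 b^2], so
    [b^2 = 0]. Replacing [x] by [b^* x] gives [(b^* b)^2 = 0], and the
    C*-identity, applied twice, gives [b = 0]. *)
Require Import Defs.
From HB Require Import structures.
From mathcomp Require Import all_boot all_order all_algebra.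
From mathcomp Require Import all_classical all_reals all_analysis.
From mathcomp Require Import complex.

Set Implicit Arguments.
Unset Strict Implicit.
Unset Printing Implicit Defensive.

Import Order.TTheory GRing.Theory Num.Theory.
Local Open Scope classical_set_scope.
Local Open Scope ring_scope.

Section CStar.
Variables (R : realType) (C : cstarAlgType R).
Implicit Types (x y : C) (B : set C).

Lemma starM_mul x y : star (x * y) = star y * star x.
Proof. exact: starM. Qed.

Lemma star_mul_eq0 x : star x * x = 0 -> x = 0.
Proof.
move=> xx0; have := cstar_identity x; rewrite [cstar_mul _ _]xx0 normr0.
by move/esym/eqP; rewrite expf_eq0 normr_eq0 => /andP[_ /eqP].
Qed.

(** Since [star x * x] is selfadjoint, its square again has the form [star z * z], so the
    C*-identity applies first to [z = star x * x] and then to [x]. *)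
Lemma star_mul_sqr_eq0 x : (star x * x) ^+ 2 = 0 -> x = 0.
Proof.
rewrite expr2 => h; apply: star_mul_eq0; apply: star_mul_eq0.
by rewrite starM_mul starK.
Qed.

(** Replaces cancellation by a unit, which [B] may lack: two-sided multiplication by elements of [B]
    still separates the elements of [B]. *)
Lemma selfadjoint_nondegenerate B (d : C) :
  GRing.mulr_2closed (mem B) -> {homo star : b / b \in B} -> d \in B ->
  (forall b1 b2, b1 \in B -> b2 \in B -> b1 * d * b2 = 0) -> d = 0.
Proof.
move=> BM Bstar dB d0; apply: star_mul_sqr_eq0.
(* The test elements are [b1 = star d] and [b2 = star d * d], for which
   [b1 * d * b2 = (star d * d) ^+ 2]. *)
by rewrite expr2; apply: d0; [exact: Bstar | apply: BM => //; exact: Bstar].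
Qed.

End CStar.

Section JordanBimoduleMap.
Variables (R : realType) (C : cstarAlgType R) (A B : set C).
Variable (P : {fun A >-> B}).
Hypotheses (Aalg : GRing.subalg_closed (mem A)) (BA : B `<=` A)
  (Bmod : GRing.submod_closed (mem B)) (BM : GRing.mulr_2closed (mem B))
  (Bstar : {homo star : b / b \in B}).
Hypotheses (Plin : linear_on A P) (Pbimod : bimodule_map_on A B P)
  (Psqr : {in A, forall a, P (a ^+ 2) = P a ^+ 2}).

Let BAin b : b \in B -> b \in A.
Proof. by rewrite !inE; apply: BA. Qed.

Let PB a : a \in A -> P a \in B.
Proof. by rewrite !inE; apply: funS. Qed.

Let AM x y : x \in A -> y \in A -> x * y \in A.
Proof. by case: Aalg => _ _; apply. Qed.

Let AZD k x y : x \in A -> y \in A -> k *: x + y \in A.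
Proof. by case: Aalg => _ h _; apply: h. Qed.

Let AD x y : x \in A -> y \in A -> x + y \in A.
Proof. by move=> xA yA; rewrite -[x]scale1r AZD. Qed.

Let AB x y : x \in A -> y \in A -> x - y \in A.
Proof. by move=> xA yA; rewrite addrC -scaleN1r AZD. Qed.

Let BB x y : x \in B -> y \in B -> x - y \in B.
Proof.
by move=> xB yB; rewrite addrC -scaleN1r; case: Bmod => _; apply.
Qed.

Let PD x y : x \in A -> y \in A -> P (x + y) = P x + P y.
Proof. by move=> xA yA; rewrite -[x]scale1r Plin // !scale1r. Qed.

Let PN x y : x \in A -> y \in A -> P (x - y) = P x - P y.
Proof. by move=> xA yA; rewrite addrC -scaleN1r Plin // scaleN1r addrC. Qed.

Lemma bimodule_map_mull b x : b \in B -> x \in A -> P (b * x) = b * P x.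
Proof.
move=> bB xA; have bxA : b * x \in A by rewrite AM // BAin.
apply/subr0_eq/(selfadjoint_nondegenerate BM Bstar).
  by apply: BB; [exact: PB | apply: BM => //; exact: PB].
move=> b1 b2 b1B b2B; rewrite mulrBr mulrBl -Pbimod // !mulrA Pbimod //.
  by rewrite subrr.
exact: BM.
Qed.

Lemma bimodule_map_mulr b x : b \in B -> x \in A -> P (x * b) = P x * b.
Proof.
move=> bB xA; have xbA : x * b \in A by rewrite AM // BAin.
apply/subr0_eq/(selfadjoint_nondegenerate BM Bstar).
  by apply: BB; [exact: PB | apply: BM => //; exact: PB].
move=> b1 b2 b1B b2B; rewrite mulrBr mulrBl -Pbimod // -!mulrA.
rewrite [b1 * (x * _)]mulrA Pbimod //; last exact: BM.
by rewrite -!mulrA subrr.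
Qed.

Lemma jordan_polarization x y : x \in A -> y \in A ->
  P (x * y + y * x) = P x * P y + P y * P x.
Proof.
move=> xA yA.
have sqrD (u v : C) : (u + v) * (u + v) = u * u + v * v + (u * v + v * u).
  by rewrite mulrDl !mulrDr (AC (2*2) ((1*4)*(2*3))).
have xyA := AM xA yA; have yxA := AM yA xA.
have x2A := AM xA xA; have y2A := AM yA yA.
have := Psqr (AD xA yA).
rewrite !expr2 sqrD [in LHS]PD ?AD // (PD x2A y2A) -!expr2 !Psqr // (PD xA yA).
by rewrite [RHS]expr2 sqrD -!expr2 => /addrI.
Qed.

Let mulr2_eq0 (z : C) : z + z = 0 -> z = 0.
Proof.
move=> zz; have : (2 : R[i]) *: z = 0 by rewrite scaler_nat mulr2n.
by move/eqP; rewrite scaler_eq0 pnatr_eq0 => /eqP.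
Qed.

Lemma jordan_kernel_triple x y : x \in A -> y \in A -> P x = 0 -> P y = 0 ->
  P (x * y * x) = 0.
Proof.
move=> xA yA Px Py; apply: mulr2_eq0.
have xyA := AM xA yA; have yxA := AM yA xA; have xyxA := AM xyA xA.
have x2A := AM xA xA; have sA := AD xyA yxA.
have Px2 : P (x * x) = 0 by rewrite -expr2 Psqr // Px expr0n.
have Ps : P (x * y + y * x) = 0.
  by rewrite jordan_polarization // Px mul0r mulr0 addr0.
have := jordan_polarization xA sA; have := jordan_polarization x2A yA.
rewrite Px2 Ps Px !mul0r !mulr0 !addr0 => Q1 Q2.
rewrite -PD //.
(* With [u o v = u v + v u], this is [2 x y x = x o (x o y) - x^2 o y]. Polarization kills both
   terms, since [x], [x o y], [x^2] and [y] all lie in the kernel. *)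
have -> : x * y * x + x * y * x =
  (x * (x * y + y * x) + (x * y + y * x) * x) - (x * x * y + y * (x * x)).
  rewrite mulrDr mulrDl !mulrA [X in X - _](AC (2*2) ((2*3)*(1*4))).
  by rewrite addrK.
by rewrite PN ?Q1 ?Q2 ?subrr ?AD ?AM.
Qed.

Lemma jordan_kernel_mul_sqr x y : x \in A -> y \in A -> P x = 0 -> P y = 0 ->
  P (x * y) ^+ 2 = 0.
Proof.
move=> xA yA Px Py; apply: mulr2_eq0.
have xyA := AM xA yA; have yxA := AM yA xA; have xyxA := AM xyA xA.
have Pyx : P (y * x) = - P (x * y).
  apply/eqP; rewrite -addr_eq0 addrC -PD // jordan_polarization //.
  by rewrite Px mul0r mulr0 addr0.
(* The sign in [Pyx] vanishes on squaring, so the doubled square is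
   [P ((x * y) ^+ 2) + P ((y * x) ^+ 2)]. *)
rewrite -{2}[P (x * y)]opprK -Pyx sqrrN -!Psqr //.
have := jordan_polarization xyxA yA.
rewrite jordan_kernel_triple // Py !mul0r addr0 => <-.
by rewrite PD ?AM // !expr2 !mulrA.
Qed.

Lemma jordan_kernel_mul x y : x \in A -> y \in A -> P x = 0 -> P y = 0 ->
  P (x * y) = 0.
Proof.
move=> xA yA Px Py; apply: star_mul_sqr_eq0.
(* [A] need not be selfadjoint; the adjoint is taken inside [B]. As a left factor from [B] it can be
   moved into [P], and it keeps [x] in the kernel. *)
have bB : star (P (x * y)) \in B by rewrite Bstar // PB // AM.
rewrite -bimodule_map_mull ?AM // mulrA jordan_kernel_mul_sqr //.
  by rewrite AM // BAin.
by rewrite bimodule_map_mull // Px mulr0.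
Qed.

Lemma idempotent_jordan_bimodule_mul : idempotent_on A P ->
  {in A &, {morph P : x y / x * y}}.
Proof.
move=> Pidem x y xA yA.
have PxB := PB xA; have PyB := PB yA.
have PxA := BAin PxB; have PyA := BAin PyB.
have kA a : a \in A -> a - P a \in A by move=> aA; rewrite AB // BAin // PB.
(* This is where idempotence enters: [a - P a] is the kernel component of [a]. *)
have Pk a : a \in A -> P (a - P a) = 0.
  by move=> aA; rewrite PN // ?BAin ?PB // Pidem // subrr.
(* Only [x] is split in the first term: left and right [B]-linearity evaluate the first two terms to
   [P x * P y] and [0], and the last is a product of kernel elements. *)
have -> : x * y = P x * y + ((x - P x) * P y + (x - P x) * (y - P y)).
  by rewrite -mulrDr addrCA subrr addr0 -mulrDl addrCA subrr addr0.
rewrite !PD ?AD ?AM ?kA // bimodule_map_mull // bimodule_map_mulr ?kA //.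
by rewrite jordan_kernel_mul ?kA ?Pk // mul0r !addr0.
Qed.

End JordanBimoduleMap.

Theorem corollary4p4 (R : realType) (C : cstarAlgType R) (A B : set C)
    (P : {fun A >-> B}) :
  operator_algebra A ->
  closed_selfadjoint_subalgebra B A ->
  idempotent_on A P ->
  jordan_homomorphism_on A P ->
  bimodule_map_on A B P ->
  homomorphism_on A P.
Proof.
move=> [Aalg _] [BA Bmod BM Bstar _] Pidem [Plin Psqr] Pbimod.
by split=> //; apply: idempotent_jordan_bimodule_mul.
Qed.
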